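(* Let $\mathbf{A}\in\mathbb{R}^{m\times n}$ with $m<n$, let $\mathcal{D}:\mathbb{R}^{r\times p}\to\mathbb{R}^n$ be a linear map with transpose $\mathcal{D}^T:\mathbb{R}^n\to\mathbb{R}^{r\times p}$, let $x^*\in\mathbb{R}^n$, and let $I=\{i\in\{1,\dots,r\} : (\mathcal{D}^T x^* )_i\neq 0\}$. Suppose that there exist $w\in\mathbb{R}^m$ and $Y\in\mathbb{R}^{r\times p}$ such that $\mathcal{D}Y=\mathbf{A}^T w$ and $$Y_i=\frac{(\mathcal{D}^T x^* )_i}{\|(\mathcal{D}^T x^* )_i\|_2}\ \text{ for } i\in I,\qquad \|Y_i\|_2<1\ \text{ for } i\notin I,$$ and suppose that, with $S=\{v\in\mathbb{R}^n : (\mathcal{D}^T v)_i=0\ \text{for all } i\notin I\}$, for all $y,v\in S$ the equality $\mathbf{A}v=\mathbf{A}y$ implies $y=v$. Then $x^*$ is the unique solution of $$\min_{y\in\mathbb{R}^n}\|\mathcal{D}^T y\|_{1,2}\quad\text{subject to}\quad \mathbf{A}y=\mathbf{A}x^*.$$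
   Context: For a matrix $Y\in\mathbb{R}^{r\times p}$, $Y_i\in\mathbb{R}^p$ denotes its $i$-th row, and the mixed norm is $\|Y\|_{1,2}=\sum_{i=1}^r\|Y_i\|_2=\sum_{i=1}^r\big(\sum_{j=1}^p|Y_{i,j}|^2\big)^{1/2}$. In particular $(\mathcal{D}^T x)_i$ is the $i$-th row of $\mathcal{D}^T x\in\mathbb{R}^{r\times p}$. The transpose $\mathcal{D}^T$ is the adjoint of $\mathcal{D}$ with respect to the inner product $\langle Y,Z\rangle=\sum_{i=1}^r\sum_{j=1}^p Y_{ij}Z_{ij}$ on $\mathbb{R}^{r\times p}$ and the standard Euclidean inner product on $\mathbb{R}^n$. *)

(* Defs.v *)
From HB Require Import structures.
From mathcomp Require Import all_boot all_order all_algebra.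
From mathcomp Require Import classical_sets reals.

Set Implicit Arguments.
Unset Strict Implicit.
Unset Printing Implicit Defensive.

Import Order.TTheory GRing.Theory Num.Theory.

Local Open Scope ring_scope.
Local Open Scope classical_set_scope.

(* On 'cV[R]_n = 'M[R]_(n, 1) this is the standard Euclidean inner product. *)
Definition inner (R : realType) (a b : nat) (Y Z : 'M[R]_(a, b)) : R :=
  \sum_(i < a) \sum_(j < b) Y i j * Z i j.

Definition is_transpose (R : realType) (r p n : nat)
    (D : {linear 'M[R]_(r, p) -> 'cV[R]_n})
    (DT : {linear 'cV[R]_n -> 'M[R]_(r, p)}) : Prop :=
  forall (x : 'cV[R]_n) (Y : 'M[R]_(r, p)), inner (DT x) Y = inner x (D Y).

(* The norm that MathComp-Analysis puts on matrices is the sup norm, hence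
   this separate definition. *)
Definition norm2 (R : realType) (p : nat) (v : 'rV[R]_p) : R :=
  Num.sqrt (\sum_(j < p) `|v ord0 j| ^+ 2).

Definition norm12 (R : realType) (r p : nat) (Y : 'M[R]_(r, p)) : R :=
  \sum_(i < r) norm2 (row i Y).

Definition row_support (R : realType) (r p : nat) (Y : 'M[R]_(r, p)) :
    {set 'I_r} :=
  [set i | row i Y != 0]%SET.

Definition vanishing_off (R : realType) (r p n : nat)
    (DT : {linear 'cV[R]_n -> 'M[R]_(r, p)}) (I : {set 'I_r}) :
    set 'cV[R]_n :=
  [set v | forall i : 'I_r, i \notin I -> row i (DT v) = 0].

Definition is_minimizer (R : realType) (T : Type) (f : T -> R) (C : set T)
    (x : T) : Prop :=
  C x /\ forall y : T, C y -> f x <= f y.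

Lemma inner_delta (R : realType) (a b : nat) (Y : 'M[R]_(a, b)) i j :
  inner Y (delta_mx i j) = Y i j.
Proof.
rewrite /inner (bigD1 i) //= (bigD1 j) //= big1 ?addr0; last first.
  by move=> k /negPf nk; rewrite !mxE nk andbF mulr0.
rewrite big1 ?addr0 ?mxE ?eqxx ?mulr1 // => k /negPf nk.
by rewrite big1 // => l _; rewrite !mxE nk mulr0.
Qed.

(* A transpose in the sense of [is_transpose] always exists and is unique. *)
Lemma is_transpose_uniq (R : realType) (r p n : nat)
    (D : {linear 'M[R]_(r, p) -> 'cV[R]_n})
    (E F : {linear 'cV[R]_n -> 'M[R]_(r, p)}) :
  is_transpose D E -> is_transpose D F -> E =1 F.
Proof.
by move=> hE hF x; apply/matrixP=> i j; rewrite -!inner_delta hE hF.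
Qed.

Lemma is_transpose_ex (R : realType) (r p n : nat)
    (D : {linear 'M[R]_(r, p) -> 'cV[R]_n}) :
  exists DT : {linear 'cV[R]_n -> 'M[R]_(r, p)}, is_transpose D DT.
Proof.
pose g (x : 'cV[R]_n) : 'M[R]_(r, p) :=
  \matrix_(i, j) inner x (D (delta_mx i j)).
have g_lin : linear g.
  move=> a x y; apply/matrixP=> i j; rewrite !mxE /inner big_distrr -big_split.
  apply: eq_bigr => k _; rewrite /= big_distrr -big_split; apply: eq_bigr => l _.
  by rewrite !mxE mulrDl -mulrA.
pose gM := GRing.isLinear.Build _ _ _ _ g g_lin.
pose G : {linear 'cV[R]_n -> 'M[R]_(r, p)} := HB.pack g gM.
exists G => x Y; rewrite [in RHS](matrix_sum_delta Y) linear_sum /inner /=.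
under [RHS]eq_bigr => k _ do
  under eq_bigr => l _ do rewrite summxE mulr_sumr.
under [RHS]eq_bigr => k _ do rewrite exchange_big.
rewrite [RHS]exchange_big; apply: eq_bigr => i _.
under [RHS]eq_bigr => k _ do
  under eq_bigr => l _ do rewrite linear_sum summxE mulr_sumr.
under [RHS]eq_bigr => k _ do rewrite exchange_big.
rewrite [RHS]exchange_big; apply: eq_bigr => j _.
rewrite mxE /inner mulr_suml; apply: eq_bigr => k _.
rewrite mulr_suml; apply: eq_bigr => l _.
by rewrite linearZ mxE mulrCA mulrC.
Qed.

(* Main.v *)
(* The certificate makes y |-> <DT y, Y> = <A y, w> constant on the feasible
   set; Cauchy-Schwarz row by row bounds it by norm12 (DT y), with equality at
   xstar, so xstar is a minimizer. At another minimizer y every row is tight, and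
   |Y_i| < 1 off the support forces those rows of DT y to vanish; the
   injectivity of A on that subspace then gives y = xstar. *)
Require Import Defs.
From HB Require Import structures.
From mathcomp Require Import all_boot all_order all_algebra.
From mathcomp Require Import classical_sets reals ring.

Set Implicit Arguments.
Unset Strict Implicit.
Unset Printing Implicit Defensive.

Import Order.TTheory GRing.Theory Num.Theory.

Local Open Scope ring_scope.
Local Open Scope classical_set_scope.

(** Splits the pairing along the same rows as [norm12], so that the two can be compared term by
    term. *)
Lemma inner_rows (R : realType) (a b : nat) (Y Z : 'M[R]_(a, b)) :
  inner Y Z = \sum_(i < a) inner (row i Y) (row i Z).
Proof.
apply: eq_bigr => i _; rewrite /inner big_ord1.
by apply: eq_bigr => j _; rewrite !mxE.
Qed.

Lemma inner_mulmx_tr (R : realType) (m n : nat) (A : 'M[R]_(m, n))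
    (x : 'cV[R]_n) (w : 'cV[R]_m) :
  inner x (A^T *m w) = inner (A *m x) w.
Proof.
rewrite /inner.
under eq_bigr do rewrite big_ord1 mxE mulr_sumr.
under [RHS]eq_bigr do rewrite big_ord1 mxE mulr_suml.
rewrite exchange_big; apply: eq_bigr => i _; apply: eq_bigr => j _.
by rewrite !mxE mulrCA mulrA.
Qed.

Lemma norm2_ge0 (R : realType) (p : nat) (v : 'rV[R]_p) : 0 <= norm2 v.
Proof. exact: sqrtr_ge0. Qed.

Lemma sqr_norm2 (R : realType) (p : nat) (v : 'rV[R]_p) :
  norm2 v ^+ 2 = inner v v.
Proof.
rewrite sqr_sqrtr; last by apply: sumr_ge0 => j _; rewrite exprn_ge0.
rewrite /inner big_ord1; apply: eq_bigr => j _.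
by rewrite real_normK ?num_real // expr2.
Qed.

Lemma norm2_eq0 (R : realType) (p : nat) (v : 'rV[R]_p) :
  (norm2 v == 0) = (v == 0).
Proof.
rewrite -sqrf_eq0 sqr_norm2 /inner big_ord1.
rewrite psumr_eq0 => [|j _]; last by rewrite -expr2 sqr_ge0.
apply/allP/eqP => [h|-> j _]; last by rewrite mxE mulr0 eqxx.
apply/rowP => j; have := h j (mem_index_enum j).
by rewrite /= -expr2 sqrf_eq0 mxE => /eqP.
Qed.

Lemma innerC (R : realType) (a b : nat) (Y Z : 'M[R]_(a, b)) :
  inner Y Z = inner Z Y.
Proof.
by apply: eq_bigr => i _; apply: eq_bigr => j _; rewrite mulrC.
Qed.

Lemma innerZr (R : realType) (a b : nat) (k : R) (Y Z : 'M[R]_(a, b)) :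
  inner Y (k *: Z) = k * inner Y Z.
Proof.
rewrite /inner mulr_sumr; apply: eq_bigr => i _.
by rewrite mulr_sumr; apply: eq_bigr => j _; rewrite mxE mulrCA.
Qed.

Lemma inner0r (R : realType) (a b : nat) (Y : 'M[R]_(a, b)) : inner Y 0 = 0.
Proof. by rewrite -(scale0r 0) innerZr mul0r. Qed.

(** For nonzero [u] and [v], the sum of the squares of [norm2 u * v_j - norm2 v * u_j] expands to [2
    * (norm2 u * norm2 v) * (norm2 u * norm2 v - inner u v)]; it is nonnegative and the first
    factors are positive, hence so is the last up to equality with 0. *)
Lemma cauchy_schwarz_row (R : realType) (p : nat) (u v : 'rV[R]_p) :
  inner u v <= norm2 u * norm2 v.
Proof.
have [->|u0] := eqVneq u 0.
  by rewrite innerC inner0r mulr_ge0 ?norm2_ge0.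
have [->|v0] := eqVneq v 0.
  by rewrite inner0r mulr_ge0 ?norm2_ge0.
have uv_gt0 : 0 < norm2 u * norm2 v.
  by rewrite mulr_gt0 // lt_def norm2_eq0 ?u0 ?v0 norm2_ge0.
have : 0 <= \sum_j (norm2 u * v ord0 j - norm2 v * u ord0 j) ^+ 2.
  by apply: sumr_ge0 => j _; rewrite sqr_ge0.
have -> : \sum_j (norm2 u * v ord0 j - norm2 v * u ord0 j) ^+ 2 =
    norm2 u ^+ 2 * inner v v + norm2 v ^+ 2 * inner u u
    - 2 * (norm2 u * norm2 v) * inner u v.
  rewrite /inner !big_ord1 !mulr_sumr -big_split -sumrB /=.
  by apply: eq_bigr => j _; ring.
rewrite -!sqr_norm2.
have -> : norm2 u ^+ 2 * norm2 v ^+ 2 + norm2 v ^+ 2 * norm2 u ^+ 2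
    - 2 * (norm2 u * norm2 v) * inner u v =
    2 * (norm2 u * norm2 v) * (norm2 u * norm2 v - inner u v) by ring.
by rewrite pmulr_rge0 ?subr_ge0 // mulr_gt0.
Qed.

Theorem theorem3p4 (R : realType) (m n r p : nat) (hmn : (m < n)%N)
    (A : 'M[R]_(m, n))
    (D : {linear 'M[R]_(r, p) -> 'cV[R]_n})
    (DT : {linear 'cV[R]_n -> 'M[R]_(r, p)})
    (hDT : is_transpose D DT)
    (xstar : 'cV[R]_n)
    (hcert : exists (w : 'cV[R]_m) (Y : 'M[R]_(r, p)),
      D Y = A^T *m w /\
      (forall i : 'I_r, i \in row_support (DT xstar) ->
         row i Y = (norm2 (row i (DT xstar)))^-1 *: row i (DT xstar)) /\
      (forall i : 'I_r, i \notin row_support (DT xstar) ->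
         norm2 (row i Y) < 1))
    (hinj : forall y v : 'cV[R]_n,
      vanishing_off DT (row_support (DT xstar)) y ->
      vanishing_off DT (row_support (DT xstar)) v ->
      A *m v = A *m y -> y = v) :
  unique
    (is_minimizer (fun y : 'cV[R]_n => norm12 (DT y))
       [set y : 'cV[R]_n | A *m y = A *m xstar])
    xstar.
Proof.
case: hcert => w [Y [DY [Yin Yout]]].
pose I := row_support (DT xstar).
have pair_const y : A *m y = A *m xstar ->
    inner (DT y) Y = inner (DT xstar) Y.
  by move=> Ay; rewrite !hDT DY !inner_mulmx_tr Ay.
have norm_neq0 i : i \in I -> norm2 (row i (DT xstar)) != 0.
  by rewrite inE norm2_eq0.
have pair_star : inner (DT xstar) Y = norm12 (DT xstar).
  rewrite inner_rows; apply: eq_bigr => i _.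
  (* On the support, pairing a row with its own normalization returns its norm; off the support the
     row is zero and both sides vanish. *)
  have [iI|] := boolP (i \in I).
    by rewrite Yin // innerZr -sqr_norm2 expr2 mulKf // norm_neq0.
  rewrite inE negbK => /eqP ->.
  by rewrite innerC inner0r; apply/esym/eqP; rewrite norm2_eq0.
have norm_Y_le1 i : norm2 (row i Y) <= 1.
  have [iI|/Yout/ltW //] := boolP (i \in I).
  (* On the support, [row i Y] is a normalized vector; comparing squares turns its norm into an
     inner product without roots. *)
  rewrite -(@ler_pXn2r _ 2) ?nnegrE ?norm2_ge0 // expr1n sqr_norm2.
  rewrite Yin // innerZr innerC innerZr -sqr_norm2 expr2.
  by rewrite mulKf ?mulVf // norm_neq0.
have row_le (Z : 'M[R]_(r, p)) i :
    inner (row i Z) (row i Y) <= norm2 (row i Z).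
  apply: le_trans (cauchy_schwarz_row _ _) _.
  by rewrite ler_piMr ?norm2_ge0.
have pair_le Z : inner Z Y <= norm12 Z.
  by rewrite inner_rows; apply: ler_sum.
have star_min : is_minimizer (fun y : 'cV[R]_n => norm12 (DT y))
    [set y : 'cV[R]_n | A *m y = A *m xstar] xstar.
  by split=> // y Ay; rewrite -pair_star -(pair_const y Ay) pair_le.
have star_van : vanishing_off DT I xstar.
  by move=> i; rewrite inE negbK => /eqP.
split=> // y [Ay ymin].
(* Both points are feasible and [xstar] vanishes off [I], so it remains to show that [DT y] does
   too. *)
apply: hinj => // i iI.
(* The slacks add up to [norm12 (DT y) - inner (DT y) Y]. The subtracted pairing equals
   [norm12 (DT xstar)], so minimality of [y] makes the total at most 0, and [pair_le] makes it at
   least 0. Each slack is nonnegative, so each one vanishes. *)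
have /eqP sum0 : \sum_(k < r)
    (norm2 (row k (DT y)) - inner (row k (DT y)) (row k Y)) == 0.
  rewrite sumrB -inner_rows subr_eq0 eq_le pair_le andbT.
  by rewrite (pair_const y Ay) pair_star; apply: ymin.
have tight : norm2 (row i (DT y)) = inner (row i (DT y)) (row i Y).
  apply/eqP; rewrite -subr_eq0; apply/eqP.
  by apply: (psumr_eq0P _ sum0) => // k _; rewrite subr_ge0.
(* If the row were nonzero, tightness and Cauchy-Schwarz would allow cancelling its norm, giving
   [1 <= norm2 (row i Y)] at an index off the support. *)
apply/eqP; rewrite -norm2_eq0; apply: contraT => nz.
have := cauchy_schwarz_row (row i (DT y)) (row i Y).
rewrite -tight ler_pMr ?lt_def ?nz ?norm2_ge0 // leNgt.
by rewrite Yout.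
Qed.
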